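(* Let $\alpha<\beta$ be positive integers, let $t\ge0$ be an integer, and let $T:=T_{z^{t+1}\overline{z}^t}$ be the Toeplitz operator with symbol $z^{t+1}\overline{z}^t$ on the generalized derivative Hardy space $S^2_{\alpha,\beta}(\mathbb{D})$. Then $T$ is a weighted shift (with respect to the orthonormal basis of normalized monomials) whose weights are $w_n=w^{(\alpha)}_n\cdot w^{(\beta)}_n$, $n\ge0$, where for $c\in\{\alpha,\beta\}$ $$w^{(c)}_n=\sqrt{\frac{n+t+c+1}{n+c+1}}\,\sqrt{\frac{n+t+c+1}{n+c}}.$$ Moreover $w^{(\alpha)}_n$ is a two-fold product $A_nB_n$, where $(A_n)_{n\ge0}$ is the weight sequence of a $t$-alternatingly hyperexpansive weighted shift and $(B_n)_{n\ge0}$ is the weight sequence of a $(t+1)$-alternatingly hyperexpansive weighted shift; and $w^{(\beta)}_n$ is a two-fold product $C_nD_n$, where $(C_n)_{n\ge0}$ is the weight sequence of a $t$-alternatingly hyperexpansive weighted shift and $(D_n)_{n\ge0}$ is the weight sequence of a $(t+1)$-alternatingly hyperexpansive weighted shift.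
   Context: For positive integers $\alpha<\beta$, $S^2_{\alpha,\beta}(\mathbb{D})$ is the Hilbert space of analytic functions $f(z)=\sum_{n\ge0}f_nz^n$ on the unit disk with $\|f\|^2=\sum_{n=0}^\infty\frac{(n+\alpha)(n+\beta)}{\alpha\beta}|f_n|^2<\infty$; thus $\langle z^m,z^n\rangle=0$ for $m\ne n$, and $e_n=\sqrt{\frac{\alpha\beta}{(n+\alpha)(n+\beta)}}\,z^n$, $n\ge0$, is an orthonormal basis. For nonnegative integers $p,q$ one has $P(\overline{z}^pz^q)=\frac{(q+\alpha)(q+\beta)}{(q-p+\alpha)(q-p+\beta)}z^{q-p}$ if $q\ge p$ and $P(\overline{z}^pz^q)=0$ if $q<p$; the Toeplitz operator with symbol $z^a\overline{z}^b$ is the bounded linear operator with $T_{z^a\overline{z}^b}(z^m)=P(\overline{z}^bz^{a+m})$ for all $m\ge0$. A (unilateral) weighted shift with bounded positive weight sequence $(\omega_n)_{n\ge0}$ maps $u_n\mapsto\omega_nu_{n+1}$ for an orthonormal basis $(u_n)_{n\ge0}$; its moments are $\gamma_0=1$, $\gamma_n=\prod_{j=0}^{n-1}\omega_j^2$. For an integer $m\ge0$ it is $m$-alternatingly hyperexpansive if $\sum_{i=0}^m(-1)^{m-i}\binom{m}{i}\gamma_{i+j}\ge0$ for all integers $j\ge0$. *)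

(* Defs.v *)
From Stdlib Require Import Reals ClassicalEpsilon.
From Coquelicot Require Import Coquelicot.
Open Scope R_scope.

Definition disk : Type := {z : C | Cmod z < 1}.

Definition mono (n : nat) : disk -> C := fun z => Cpow (proj1_sig z) n.

(* A function is analytic on the disk iff it has such an expansion; the
   coefficients are then unique. *)
Definition has_coefs (f : disk -> C) (a : nat -> C) : Prop :=
  forall z : disk, is_pseries a (proj1_sig z) (f z).

(* Junk value when [f] is not analytic. *)
Definition coef (f : disk -> C) : nat -> C :=
  epsilon (inhabits (fun _ : nat => RtoC 0)) (has_coefs f).

Definition fadd (f g : disk -> C) : disk -> C := fun z => Cplus (f z) (g z).
Definition fscal (c : C) (f : disk -> C) : disk -> C := fun z => Cmult c (f z).
Definition fsub (f g : disk -> C) : disk -> C := fadd f (fscal (RtoC (-1)) g).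

Fixpoint fsum (F : nat -> disk -> C) (n : nat) : disk -> C :=
  match n with
  | O => fun _ => RtoC 0
  | S k => fadd (fsum F k) (F k)
  end.

Definition wt (alpha beta : nat) (n : nat) : R :=
  (INR n + INR alpha) * (INR n + INR beta) / (INR alpha * INR beta).

Definition S2 (alpha beta : nat) (f : disk -> C) : Prop :=
  (exists a, has_coefs f a) /\
  ex_series (fun n => wt alpha beta n * (Cmod (coef f n)) ^ 2).

Definition S2_norm (alpha beta : nat) (f : disk -> C) : R :=
  sqrt (Series (fun n => wt alpha beta n * (Cmod (coef f n)) ^ 2)).

(* Coquelicot's [Series] is real-valued, so the inner product
   sum_n wt n * f_n * conj (g_n) is summed by real and imaginary parts. *)
Definition S2_inner (alpha beta : nat) (f g : disk -> C) : C :=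
  let term n := Cmult (RtoC (wt alpha beta n)) (Cmult (coef f n) (Cconj (coef g n))) in
  (Series (fun n => Re (term n)), Series (fun n => Im (term n))).

Definition e (alpha beta : nat) (n : nat) : disk -> C :=
  fscal (RtoC (sqrt (INR alpha * INR beta /
                     ((INR n + INR alpha) * (INR n + INR beta)))))
        (mono n).

Definition orthonormal_basis (alpha beta : nat) (u : nat -> disk -> C) : Prop :=
  (forall n, S2 alpha beta (u n)) /\
  (forall m n, S2_inner alpha beta (u m) (u n) = RtoC (if Nat.eqb m n then 1 else 0)) /\
  (forall f, S2 alpha beta f ->
     is_lim_seq
       (fun N => S2_norm alpha beta
                   (fsub f (fsum (fun k => fscal (S2_inner alpha beta f (u k)) (u k)) N)))
       0).

(* Operators on the space are given by maps on all functions on the disk;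
   their values outside the space are irrelevant. *)
Definition bounded_linear_operator (alpha beta : nat)
    (T : (disk -> C) -> (disk -> C)) : Prop :=
  (forall f, S2 alpha beta f -> S2 alpha beta (T f)) /\
  (forall f g, S2 alpha beta f -> S2 alpha beta g -> T (fadd f g) = fadd (T f) (T g)) /\
  (forall c f, S2 alpha beta f -> T (fscal c f) = fscal c (T f)) /\
  (exists M : R, forall f, S2 alpha beta f -> S2_norm alpha beta (T f) <= M * S2_norm alpha beta f).

(* P (conj(z)^p z^q); the natural-number subtraction q - p is exact in the
   branch where it is used. *)
Definition P_mono (alpha beta : nat) (p q : nat) : disk -> C :=
  if Nat.leb p q then
    fscal (RtoC ((INR q + INR alpha) * (INR q + INR beta) /
                 ((INR (q - p) + INR alpha) * (INR (q - p) + INR beta))))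
          (mono (q - p))
  else fun _ => RtoC 0.

(* T is the Toeplitz operator with symbol z^a conj(z)^b; polynomials being
   dense, this determines T on the space. *)
Definition is_toeplitz (alpha beta : nat) (a b : nat) (T : (disk -> C) -> (disk -> C)) : Prop :=
  bounded_linear_operator alpha beta T /\
  (forall m, T (mono m) = P_mono alpha beta b (a + m)).

Definition weight_sequence (w : nat -> R) : Prop :=
  (forall n, 0 < w n) /\ (exists M : R, forall n, w n <= M).

Definition is_weighted_shift (alpha beta : nat)
    (T : (disk -> C) -> (disk -> C)) (u : nat -> disk -> C) (w : nat -> R)
    : Prop :=
  bounded_linear_operator alpha beta T /\
  orthonormal_basis alpha beta u /\
  weight_sequence w /\
  (forall n, T (u n) = fscal (RtoC (w n)) (u (S n))).

Fixpoint moment (w : nat -> R) (n : nat) : R :=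
  match n with
  | O => 1
  | S k => moment w k * (w k) ^ 2
  end.

(* w is the weight sequence of an m-alternatingly hyperexpansive weighted
   shift; the condition on the shift only involves its moments. *)
Definition alternatingly_hyperexpansive (m : nat) (w : nat -> R) : Prop :=
  weight_sequence w /\
  (forall j : nat,
     0 <= sum_f_R0
            (fun i => (-1) ^ (m - i) * Binomial.C m i * moment w (i + j)) m).

(* The factor w^(c)_n for c in {alpha, beta}. *)
Definition wfactor (t c n : nat) : R :=
  sqrt ((INR n + INR t + INR c + 1) / (INR n + INR c + 1)) *
  sqrt ((INR n + INR t + INR c + 1) / (INR n + INR c)).

(* Main.v *)
(** The moments of the shift with squared weights (n + x + s) / (n + x) telescope
    to (n + x)_s / (x)_s, where (x)_s = x (x + 1) ... (x + s - 1) is the rising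
    factorial.  As a function of n this is a polynomial of degree s, with s-th
    finite difference the constant s! / (x)_s > 0, so the shift is
    s-alternatingly hyperexpansive.  The cases x = c + 1, s = t and x = c, s = t + 1
    are the two factors of w^(c). *)
Require Import Defs.
From Stdlib Require Import Reals Lra Lia ClassicalEpsilon FunctionalExtensionality.
From Coquelicot Require Import Coquelicot.
Open Scope R_scope.

(** * Iterated forward differences *)

Definition alt_sum (m : nat) (f : nat -> R) (j : nat) : R :=
  sum_f_R0 (fun i => (-1) ^ (m - i) * Binomial.C m i * f (i + j)%nat) m.

Lemma alt_sum_ext (m : nat) (f g : nat -> R) (j : nat) :
  (forall n, f n = g n) -> alt_sum m f j = alt_sum m g j.
Proof. intros H. apply sum_eq. intros i _. now rewrite H. Qed.

Lemma alt_sum_scal (m : nat) (c : R) (f : nat -> R) (j : nat) :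
  alt_sum m (fun n => c * f n) j = c * alt_sum m f j.
Proof.
  unfold alt_sum. rewrite scal_sum. apply sum_eq. intros i _. ring.
Qed.

(** By Pascal's rule the difference of order [m + 1] is the difference of order [m] of the first
    difference. This makes induction on the order possible. *)
Lemma alt_sum_S (m : nat) (f : nat -> R) (j : nat) :
  alt_sum (S m) f j = alt_sum m (fun n => f (S n) - f n) j.
Proof.
  unfold alt_sum.
  rewrite (sum_eq _ (fun i => (-1) ^ (m - i) * Binomial.C m i * f (S i + j)%nat
     - (-1) ^ (m - i) * Binomial.C m i * f (i + j)%nat) m)
    by (intros i _; simpl; ring).
  rewrite minus_sum.
  destruct m as [|m].
  { simpl. rewrite !C_n_0, C_n_n. ring. }
  (* The first and last terms are split off, since [pascal] covers only the interior binomial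
     coefficients; for [m = 0] there are none, hence the separate case above. *)
  rewrite (decomp_sum _ (S (S m))) by lia.
  rewrite (decomp_sum (fun i => _ * f (i + j)%nat) (S m)) by lia.
  simpl pred. rewrite !tech5, !C_n_0, !C_n_n.
  rewrite (sum_eq (fun i => (-1) ^ (S (S m) - S i) * _ * _)
     (fun i => (-1) ^ (S m - i) * Binomial.C (S m) i * f (S i + j)%nat
        - (-1) ^ (S m - S i) * Binomial.C (S m) (S i) * f (S i + j)%nat) m).
  - rewrite minus_sum, !Nat.sub_diag, !Nat.sub_0_r. simpl. ring.
  - intros i Hi. rewrite <- pascal by lia.
    replace (S (S m) - S i)%nat with (S (m - i)) by lia.
    replace (S m - i)%nat with (S (m - i)) by lia.
    replace (S m - S i)%nat with (m - i)%nat by lia.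
    simpl. ring.
Qed.

(** * Rising factorials and moments *)

Fixpoint rising (x : R) (k : nat) : R :=
  match k with
  | O => 1
  | S k => rising x k * (x + INR k)
  end.

Lemma rising_pos (x : R) (k : nat) : 0 < x -> 0 < rising x k.
Proof.
  intros Hx. induction k as [|k IH]; simpl; [lra|].
  apply Rmult_lt_0_compat; [easy|]. pose proof (pos_INR k). lra.
Qed.

(** Both sides are the product of the [k + 1] factors from [x] to [x + k]. *)
Lemma rising_shift (x : R) (k : nat) : x * rising (x + 1) k = rising x k * (x + INR k).
Proof.
  induction k as [|k IH]; [simpl; ring|].
  rewrite S_INR. simpl rising. rewrite <- Rmult_assoc, IH. ring.
Qed.

(** The discrete power rule: both terms on the left contain the factor [rising (x + 1) k], and their
    remaining factors [x + 1 + k] and [x] differ by [k + 1]. *)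
Lemma rising_diff (x : R) (k : nat) :
  rising (x + 1) (S k) - rising x (S k) = INR (S k) * rising (x + 1) k.
Proof.
  rewrite S_INR. simpl. rewrite <- (rising_shift x). ring.
Qed.

(** Each difference lowers the degree by one and moves [x] to [x + 1], so the induction has to keep
    [x] general. *)
Lemma alt_sum_rising_nonneg (m j : nat) : forall x,
  0 <= alt_sum m (fun n => rising (INR n + x) m) j.
Proof.
  induction m as [|m IH]; intros x.
  - unfold alt_sum. simpl. rewrite C_n_0. lra.
  - rewrite alt_sum_S.
    rewrite (alt_sum_ext _ _ (fun n => INR (S m) * rising (INR n + (x + 1)) m)).
    + rewrite alt_sum_scal. apply Rmult_le_pos; [apply pos_INR | apply IH].
    + intros n. replace (INR (S n) + x) with (INR n + x + 1) by (rewrite S_INR; ring).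
      rewrite rising_diff. do 2 f_equal. ring.
Qed.

Lemma moment_rising (s : nat) (x : R) (n : nat) : 0 < x ->
  moment (fun n => sqrt ((INR n + x + INR s) / (INR n + x))) n
  = / rising x s * rising (INR n + x) s.
Proof.
  intros Hx. pose proof (rising_pos x s Hx) as Hr. pose proof (pos_INR s) as Hs.
  induction n as [|n IH].
  - simpl moment. simpl INR. rewrite Rplus_0_l. field. lra.
  - pose proof (pos_INR n) as Hn. simpl moment.
    rewrite IH. fold (((sqrt ((INR n + x + INR s) / (INR n + x)))) ^ 2).
    rewrite pow2_sqrt by (apply Rdiv_le_0_compat; lra).
    replace (INR (S n) + x) with (INR n + x + 1) by (rewrite S_INR; ring).
    pose proof (rising_shift (INR n + x) s) as E.
    (* Multiplying by the denominator of the new squared weight brings the goal to the division-free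
       form of [rising_shift]. *)
    apply Rmult_eq_reg_l with (INR n + x); [|lra].
    replace ((INR n + x) * (/ rising x s * rising (INR n + x + 1) s))
      with (/ rising x s * ((INR n + x) * rising (INR n + x + 1) s)) by ring.
    rewrite E. field. lra.
Qed.

(** * Weight sequences and the factorization of [wfactor] *)

Lemma weight_sequence_sqrt (s : nat) (x : R) : 0 < x ->
  weight_sequence (fun n => sqrt ((INR n + x + INR s) / (INR n + x))).
Proof.
  intros Hx. pose proof (pos_INR s) as Hs. split.
  - intros n. pose proof (pos_INR n) as Hn. apply sqrt_lt_R0.
    apply Rdiv_lt_0_compat; lra.
  (* The bound is the weight at index 0: the radicand [1 + s / (n + x)] does not increase with
     [n]. *)
  - exists (sqrt ((x + INR s) / x)). intros n. pose proof (pos_INR n) as Hn.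
    apply sqrt_le_1_alt.
    replace ((INR n + x + INR s) / (INR n + x)) with (1 + INR s * / (INR n + x))
      by (field; lra).
    replace ((x + INR s) / x) with (1 + INR s * / x) by (field; lra).
    apply Rplus_le_compat_l, Rmult_le_compat_l; [easy|].
    apply Rinv_le_contravar; lra.
Qed.

Lemma weight_sequence_mult (v w : nat -> R) :
  weight_sequence v -> weight_sequence w -> weight_sequence (fun n => v n * w n).
Proof.
  intros [Hv [M HM]] [Hw [N HN]]. split.
  - intros n. now apply Rmult_lt_0_compat.
  - exists (M * N). intros n.
    apply Rmult_le_compat; auto using Rlt_le.
Qed.

Lemma alternatingly_hyperexpansive_sqrt (s : nat) (x : R) : 0 < x ->
  alternatingly_hyperexpansive s (fun n => sqrt ((INR n + x + INR s) / (INR n + x))).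
Proof.
  intros Hx. split; [now apply weight_sequence_sqrt|]. intros j.
  change (0 <= alt_sum s
    (moment (fun n => sqrt ((INR n + x + INR s) / (INR n + x)))) j).
  rewrite (alt_sum_ext _ _ (fun n => / rising x s * rising (INR n + x) s))
    by (intros n; now apply moment_rising).
  rewrite alt_sum_scal. apply Rmult_le_pos; [|apply alt_sum_rising_nonneg].
  apply Rlt_le, Rinv_0_lt_compat, rising_pos, Hx.
Qed.

Lemma wfactor_factors (t c n : nat) :
  wfactor t c n
  = sqrt ((INR n + (INR c + 1) + INR t) / (INR n + (INR c + 1)))
    * sqrt ((INR n + INR c + INR (t + 1)) / (INR n + INR c)).
Proof.
  unfold wfactor. rewrite plus_INR. simpl (INR 1).
  f_equal; f_equal; f_equal; ring.
Qed.

Lemma wfactor_hyperexpansive_factorization (t c : nat) : (0 < c)%nat ->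
  exists A B : nat -> R,
    (forall n, wfactor t c n = A n * B n) /\
    alternatingly_hyperexpansive t A /\
    alternatingly_hyperexpansive (t + 1) B.
Proof.
  intros Hc. apply lt_0_INR in Hc.
  exists (fun n => sqrt ((INR n + (INR c + 1) + INR t) / (INR n + (INR c + 1)))).
  exists (fun n => sqrt ((INR n + INR c + INR (t + 1)) / (INR n + INR c))).
  split; [intros n; apply wfactor_factors|].
  split; apply alternatingly_hyperexpansive_sqrt; lra.
Qed.

(** Positivity and boundedness pass from the two factors to their product. *)
Lemma weight_sequence_wfactor (t c : nat) : (0 < c)%nat -> weight_sequence (wfactor t c).
Proof.
  intros Hc.
  destruct (wfactor_hyperexpansive_factorization t c Hc) as (A & B & E & [HA _] & [HB _]).
  rewrite (functional_extensionality _ _ E). now apply weight_sequence_mult.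
Qed.

(** * Series with one nonzero term and uniqueness of power series coefficients *)

Lemma is_series_single {K : AbsRing} {V : NormedModule K} (a : nat -> V) (n : nat) :
  (forall k, k <> n -> a k = zero) -> is_series a (a n).
Proof.
  intros Ha.
  assert (Hlt : forall N, (N < n)%nat -> sum_n a N = zero).
  { induction N as [|N IH]; intros HN.
    - rewrite sum_O. apply Ha. lia.
    - rewrite sum_Sn, IH, Ha by lia. apply plus_zero_l. }
  assert (Hge : forall d, sum_n a (n + d) = a n).
  { induction d as [|d IH].
    - rewrite Nat.add_0_r. destruct n as [|n]; [apply sum_O|].
      rewrite sum_Sn, Hlt by lia. apply plus_zero_l.
    - rewrite Nat.add_succ_r, sum_Sn, IH, (Ha (S (n + d))) by lia. apply plus_zero_r. }
  apply filterlim_ext_loc with (fun _ => a n); [|apply filterlim_const].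
  exists n. intros N HN. replace N with (n + (N - n))%nat by lia. now rewrite Hge.
Qed.

Lemma Series_single (a : nat -> R) (n : nat) :
  (forall k, k <> n -> a k = 0) -> Series a = a n.
Proof. intros Ha. apply is_series_unique. now apply (is_series_single a n). Qed.

Lemma pow_n_Cpow (z : C) (n : nat) : pow_n (z : C_AbsRing) n = Cpow z n.
Proof. induction n as [|n IH]; [easy|]. simpl. now rewrite IH. Qed.

(** Additivity carries partial sums to partial sums, and continuity carries the limit. The scalar
    rings may differ so that [phi] can be the real or imaginary part. *)
Lemma is_series_map {K L : AbsRing} {V : NormedModule K} {W : NormedModule L}
    (phi : V -> W) (a : nat -> V) (l : V) :
  (forall x y, phi (plus x y) = plus (phi x) (phi y)) ->
  filterlim phi (locally l) (locally (phi l)) ->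
  is_series a l -> is_series (fun n => phi (a n)) (phi l).
Proof.
  intros Hadd Hcont Ha.
  apply filterlim_ext with (fun N => phi (sum_n a N)).
  - induction x as [|N IH]; [now rewrite !sum_O|]. now rewrite !sum_Sn, Hadd, IH.
  - now apply filterlim_comp with (locally l).
Qed.

(** The terms of a convergent series tend to 0, hence are bounded, so the radius of convergence is
    at least [x]. *)
Lemma is_pseries_bounded (a : nat -> R) (x l : R) :
  0 < x -> is_pseries a x l -> Rbar_lt 0 (CV_radius a).
Proof.
  intros Hx Ha. apply Rbar_lt_le_trans with x; [easy|].
  apply CV_radius_bounded.
  assert (H : is_lim_seq (fun n => a n * x ^ n) 0).
  { apply is_lim_seq_ext with (fun n => scal (pow_n x n) (a n)).
    - intros n. rewrite pow_n_pow. apply Rmult_comm.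
    - apply ex_series_lim_0. now exists l. }
  destruct (filterlim_bounded (fun n => a n * x ^ n)) as [M HM].
  - now exists 0.
  - exists M. exact HM.
Qed.

Lemma pseries_coef_unique (a b : nat -> R) (g : R -> R) :
  (forall x, Rabs x < 1 -> is_pseries a x (g x)) ->
  (forall x, Rabs x < 1 -> is_pseries b x (g x)) ->
  forall n, a n = b n.
Proof.
  intros Ha Hb n.
  assert (Hh : Rabs (1/2) < 1) by (rewrite Rabs_pos_eq; lra).
  apply PSeries_ext_recip.
  - apply is_pseries_bounded with (1/2) (g (1/2)); auto; lra.
  - apply is_pseries_bounded with (1/2) (g (1/2)); auto; lra.
  - exists (mkposreal 1 Rlt_0_1). intros x Hx.
    assert (H : Rabs x < 1).
    { change (Rabs (x - 0) < 1) in Hx. now rewrite Rminus_0_r in Hx. }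
    now rewrite (is_pseries_unique _ _ _ (Ha x H)), (is_pseries_unique _ _ _ (Hb x H)).
Qed.

Lemma has_coefs_unique (f : disk -> C) (a b : nat -> C) (n : nat) :
  has_coefs f a -> has_coefs f b -> a n = b n.
Proof.
  intros Ha Hb.
  assert (Hd : forall x : R, Rabs x < 1 -> Cmod (RtoC x) < 1)
    by (intros x; now rewrite Cmod_R).
  (* restricting to the real diameter turns the real and imaginary parts of
     the coefficients into coefficients of real power series *)
  assert (Hproj : forall phi : C -> R,
    (forall x y, phi (Cplus x y) = phi x + phi y) ->
    (forall (r : R) c, phi (Cmult r c) = r * phi c) ->
    (forall l : C_NormedModule, filterlim (phi : C_NormedModule -> R_NormedModule)
        (locally l) (locally (phi l))) ->
    phi (a n) = phi (b n)).
  { intros phi Hadd Hscal Hcont.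
    assert (Hser : forall c, has_coefs f c -> forall x (H : Rabs x < 1),
      is_pseries (fun k => phi (c k)) x (phi (f (exist _ (RtoC x) (Hd x H))))).
    { intros c Hc x H.
      pose proof (is_series_map (phi : C_NormedModule -> R_NormedModule) _ _ Hadd (Hcont _)
        (Hc (exist _ (RtoC x) (Hd x H)))) as E.
      apply is_series_ext with (2 := E). intros k. simpl proj1_sig.
      change (phi (Cmult (pow_n (RtoC x : C_AbsRing) k) (c k)) = pow_n x k * phi (c k)).
      rewrite pow_n_Cpow, <- RtoC_pow, Hscal. reflexivity. }
    apply (pseries_coef_unique (fun k => phi (a k)) (fun k => phi (b k))
      (* The sum must be a total function on the reals, while a point of [disk] carries a proof of
         its bound; the default 0 is taken only where the modulus is at least 1. *)
      (fun x => match Rlt_dec (Rabs x) 1 with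
                | left H => phi (f (exist _ (RtoC x) (Hd x H)))
                | right _ => 0 end));
    intros x Hx; (destruct (Rlt_dec (Rabs x) 1) as [H|]; [now apply Hser | easy]). }
  apply injective_projections; apply Hproj.
  - easy.
  - intros r c. apply re_scal_l.
  (* A ball of the complex plane is here a product of two real balls, so the same radius serves. *)
  - intros l P [eps HP]. exists eps. intros y Hy. apply HP, Hy.
  - easy.
  - intros r c. apply im_scal_l.
  - intros l P [eps HP]. exists eps. intros y Hy. apply HP, Hy.
Qed.

(** * Taylor coefficients of functions on the disk *)

Lemma has_coefs_coef (f : disk -> C) (a : nat -> C) : has_coefs f a -> has_coefs f (coef f).
Proof. intros Ha. unfold coef. apply epsilon_spec. now exists a. Qed.

(** Uniqueness turns the choice made by [epsilon] into a computation: coefficients can be read off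
    any expansion. *)
Lemma coef_eq (f : disk -> C) (a : nat -> C) (n : nat) : has_coefs f a -> coef f n = a n.
Proof.
  intros Ha. apply has_coefs_unique with f; [|easy]. now apply has_coefs_coef with a.
Qed.

Lemma has_coefs_mono (n : nat) :
  has_coefs (mono n) (fun k => RtoC (if Nat.eqb k n then 1 else 0)).
Proof.
  intros z. unfold is_pseries.
  replace (mono n z) with
    (scal (pow_n (proj1_sig z : C_AbsRing) n)
       (RtoC (if Nat.eqb n n then 1 else 0) : C_NormedModule)).
  - apply (is_series_single (fun k => scal (pow_n (proj1_sig z : C_AbsRing) k)
       (RtoC (if Nat.eqb k n then 1 else 0) : C_NormedModule))).
    intros k Hk. apply Nat.eqb_neq in Hk. rewrite Hk. apply (@scal_zero_r _ C_NormedModule).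
  - rewrite Nat.eqb_refl. change (Cmult (pow_n (proj1_sig z : C_AbsRing) n) 1 = mono n z).
    rewrite Cmult_1_r. apply pow_n_Cpow.
Qed.

Lemma has_coefs_add (f g : disk -> C) (a b : nat -> C) :
  has_coefs f a -> has_coefs g b -> has_coefs (fadd f g) (fun n => Cplus (a n) (b n)).
Proof.
  intros Ha Hb z. pose proof (is_series_plus _ _ _ _ (Ha z) (Hb z)) as H.
  apply is_series_ext with (2 := H). intros n. symmetry. apply @scal_distr_l.
Qed.

Lemma has_coefs_scal (c : C) (f : disk -> C) (a : nat -> C) :
  has_coefs f a -> has_coefs (fscal c f) (fun n => Cmult c (a n)).
Proof.
  intros Ha z. pose proof (is_series_scal c _ _ (Ha z)) as H.
  apply is_series_ext with (2 := H). intros n.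
  set (p := pow_n (proj1_sig z : C_AbsRing) n).
  change (Cmult c (Cmult p (a n)) = Cmult p (Cmult c (a n))). ring.
Qed.

Lemma has_coefs_fsum_fscal_mono (c : nat -> C) (N : nat) :
  has_coefs (fsum (fun k => fscal (c k) (mono k)) N)
    (fun k => if Nat.ltb k N then c k else RtoC 0).
Proof.
  induction N as [|N IH]; intros z.
  - apply is_series_ext with (fun _ => (zero : C_NormedModule)).
    + intros k. symmetry. apply @scal_zero_r.
    + now apply (is_series_single (fun _ => (zero : C_NormedModule)) 0).
  - pose proof (has_coefs_add _ _ _ _ IH (has_coefs_scal (c N) _ _ (has_coefs_mono N)) z) as H.
    apply is_series_ext with (2 := H). intros k. simpl. f_equal.
    destruct (Nat.eqb_spec k N), (Nat.ltb_spec k N), (Nat.ltb_spec k (S N));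
      try lia; subst; ring.
Qed.

(** * The normalized monomials as an orthonormal basis *)

Definition e_scale (alpha beta n : nat) : R :=
  sqrt (INR alpha * INR beta / ((INR n + INR alpha) * (INR n + INR beta))).

Lemma wt_e_scale (alpha beta n : nat) : (0 < alpha)%nat -> (0 < beta)%nat ->
  wt alpha beta n * e_scale alpha beta n ^ 2 = 1.
Proof.
  intros Ha Hb. apply lt_0_INR in Ha, Hb. pose proof (pos_INR n) as Hn.
  unfold wt, e_scale. rewrite pow2_sqrt.
  - field. lra.
  - apply Rlt_le, Rdiv_lt_0_compat; apply Rmult_lt_0_compat; lra.
Qed.

Lemma coef_fscal_mono (c : C) (n k : nat) :
  coef (fscal c (mono n)) k = if Nat.eqb k n then c else RtoC 0.
Proof.
  rewrite (coef_eq _ _ k (has_coefs_scal c _ _ (has_coefs_mono n))).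
  destruct (Nat.eqb k n); ring.
Qed.

Lemma S2_fscal_mono (alpha beta : nat) (c : C) (n : nat) : S2 alpha beta (fscal c (mono n)).
Proof.
  split; [eexists; apply has_coefs_scal, has_coefs_mono|].
  eexists. apply (is_series_single _ n). intros k Hk.
  rewrite coef_fscal_mono. apply Nat.eqb_neq in Hk. rewrite Hk, Cmod_0.
  change (wt alpha beta k * 0 ^ 2 = 0). ring.
Qed.

Lemma S2_mono (alpha beta n : nat) : S2 alpha beta (mono n).
Proof.
  replace (mono n) with (fscal (RtoC 1) (mono n)); [apply S2_fscal_mono|].
  apply functional_extensionality. intros z. apply Cmult_1_l.
Qed.

(** Only the term of index [n] survives, and conjugation fixes the real scalar [r]. *)
Lemma S2_inner_fscal_mono (alpha beta : nat) (f : disk -> C) (r : R) (n : nat) :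
  S2_inner alpha beta f (fscal (RtoC r) (mono n))
  = Cmult (RtoC (wt alpha beta n * r)) (coef f n).
Proof.
  unfold S2_inner.
  assert (Ht : forall k, Cmult (RtoC (wt alpha beta k)) (Cmult (coef f k)
      (Cconj (coef (fscal (RtoC r) (mono n)) k)))
    = if Nat.eqb k n then Cmult (RtoC (wt alpha beta n * r)) (coef f n) else RtoC 0).
  { intros k. rewrite coef_fscal_mono. destruct (Nat.eqb_spec k n) as [->|_].
    - replace (Cconj (RtoC r)) with (RtoC r)
        by (unfold Cconj, RtoC; simpl; now rewrite Ropp_0).
      rewrite RtoC_mult. ring.
    - replace (Cconj (RtoC 0)) with (RtoC 0)
        by (unfold Cconj, RtoC; simpl; now rewrite Ropp_0).
      ring. }
  rewrite (Series_ext _ _ (fun k => f_equal Re (Ht k))).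
  rewrite (Series_ext _ _ (fun k => f_equal Im (Ht k))).
  rewrite (Series_single _ n), (Series_single _ n), Nat.eqb_refl.
  - now destruct (Cmult (RtoC (wt alpha beta n * r)) (coef f n)).
  - intros k Hk. apply Nat.eqb_neq in Hk. now rewrite Hk.
  - intros k Hk. apply Nat.eqb_neq in Hk. now rewrite Hk.
Qed.

Lemma is_lim_seq_Series_tail (b : nat -> R) : ex_series b ->
  is_lim_seq (fun N => Series (fun n => if Nat.ltb n N then 0 else b n)) 0.
Proof.
  (* The shift to [S N] matches [sum_n b N], which includes the term of index [N]; the tail is then
     the total minus this partial sum. *)
  intros Hb. apply is_lim_seq_incr_1.
  apply is_lim_seq_ext with (fun N => Series b - sum_n b N).
  - intros N. symmetry. rewrite (Series_incr_n_aux _ (S N)).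
    + rewrite (Series_incr_n b (S N)) by (try lia; easy). rewrite sum_n_Reals. simpl pred.
      rewrite (Series_ext (fun k => if Nat.ltb _ _ then _ else _)
        (fun k => b (S N + k)%nat)); [ring|].
      intros k. destruct (Nat.ltb_spec (S N + k) (S N)); [lia|easy].
    + intros k Hk. apply Nat.ltb_lt in Hk. now rewrite Hk.
  - replace (Finite 0) with (Finite (Series b - Series b)) by (f_equal; ring).
    apply is_lim_seq_minus'; [apply is_lim_seq_const|].
    exact (Series_correct b Hb).
Qed.

(** The expansion of [f] along [e] is its Taylor expansion, so the squared norm of the remainder is
    a tail of the convergent series defining the norm of [f]. *)
Lemma orthonormal_basis_e (alpha beta : nat) : (0 < alpha)%nat -> (0 < beta)%nat ->
  orthonormal_basis alpha beta (e alpha beta).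
Proof.
  intros Ha Hb. split; [|split].
  - intros n. apply S2_fscal_mono.
  - intros m n. unfold e.
    fold (e_scale alpha beta m) (e_scale alpha beta n).
    rewrite S2_inner_fscal_mono, coef_fscal_mono, (Nat.eqb_sym n m).
    destruct (Nat.eqb_spec m n) as [->|_]; [|ring].
    rewrite <- RtoC_mult. f_equal.
    rewrite <- (wt_e_scale alpha beta n Ha Hb). ring.
  - intros f [[a Hfa] Hf].
    pose proof (has_coefs_coef f a Hfa) as Hc.
    apply is_lim_seq_ext with (fun N => sqrt (Series (fun n =>
      if Nat.ltb n N then 0 else wt alpha beta n * Cmod (coef f n) ^ 2))).
    + intros N. unfold S2_norm. f_equal. apply Series_ext. intros n.
      replace (fsum (fun k => fscal (S2_inner alpha beta f (e alpha beta k)) (e alpha beta k)) N)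
        with (fsum (fun k => fscal (coef f k) (mono k)) N).
      * unfold fsub.
        rewrite (coef_eq _ _ n (has_coefs_add _ _ _ _ Hc (has_coefs_scal (RtoC (-1)) _ _
          (has_coefs_fsum_fscal_mono (coef f) N)))).
        destruct (Nat.ltb n N).
        -- replace (Cplus (coef f n) _) with (RtoC 0) by ring. rewrite Cmod_0. ring.
        -- do 3 f_equal. ring.
      * f_equal. apply functional_extensionality. intros k.
        apply functional_extensionality. intros z. unfold e, fscal at 2.
        fold (e_scale alpha beta k). rewrite S2_inner_fscal_mono. unfold fscal.
        (* One factor [e_scale] comes from the inner product and one from the basis vector; together
           they cancel the weight. *)
        transitivity (Cmult (RtoC (wt alpha beta k * e_scale alpha beta k ^ 2))
          (Cmult (coef f k) (mono k z))).
        -- rewrite wt_e_scale by easy. ring.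
        -- rewrite !RtoC_mult. simpl pow. rewrite !RtoC_mult. ring.
    + replace (Finite 0) with (Finite (sqrt 0)) by now rewrite sqrt_0.
      apply is_lim_seq_continuous; [|now apply is_lim_seq_Series_tail].
      apply continuity_pt_filterlim, continuous_sqrt.
Qed.

(** * The Toeplitz operator on the basis, and the conclusion *)

Lemma toeplitz_e (alpha beta t n : nat) (T : (disk -> C) -> (disk -> C)) :
  (0 < alpha)%nat -> (0 < beta)%nat -> is_toeplitz alpha beta (t + 1) t T ->
  T (e alpha beta n)
  = fscal (RtoC (wfactor t alpha n * wfactor t beta n)) (e alpha beta (S n)).
Proof.
  intros Ha Hb [(_ & _ & Hscal & _) HT]. unfold e.
  rewrite Hscal by apply S2_mono. rewrite HT. unfold P_mono.
  (* The exponent [t + 1 + n] is at least [t], so the projection is in its nonzero branch, and the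
     resulting degree is exactly [n + 1]. *)
  replace (Nat.leb t (t + 1 + n)) with true by (symmetry; apply Nat.leb_le; lia).
  replace (t + 1 + n - t)%nat with (S n) by lia.
  apply functional_extensionality. intros z. unfold fscal.
  rewrite !Cmult_assoc, <- !RtoC_mult. do 2 f_equal.
  apply lt_0_INR in Ha, Hb. pose proof (pos_INR n) as Hn. pose proof (pos_INR t) as Ht.
  rewrite S_INR, !plus_INR. simpl (INR 1). unfold wfactor.
  (* Both constants are nonnegative, so comparing squares removes the roots and leaves an identity
     of rational functions. *)
  apply Rsqr_inj.
  - repeat apply Rmult_le_pos; try apply sqrt_pos;
      try (apply Rlt_le, Rinv_0_lt_compat); try apply Rmult_lt_0_compat; lra.
  - repeat apply Rmult_le_pos; apply sqrt_pos.
  - rewrite !Rsqr_mult, !Rsqr_sqrt;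
      try (apply Rlt_le, Rdiv_lt_0_compat; try apply Rmult_lt_0_compat; lra).
    unfold Rsqr. field. lra.
Qed.

Theorem theorem2p15 (alpha beta t : nat)
    (halpha : (0 < alpha)%nat) (hbeta : (alpha < beta)%nat)
    (T : (disk -> C) -> (disk -> C))
    (hT : is_toeplitz alpha beta (t + 1) t T) :
  is_weighted_shift alpha beta T (e alpha beta)
    (fun n => wfactor t alpha n * wfactor t beta n) /\
  (exists A B : nat -> R,
     (forall n, wfactor t alpha n = A n * B n) /\
     alternatingly_hyperexpansive t A /\
     alternatingly_hyperexpansive (t + 1) B) /\
  (exists C D : nat -> R,
     (forall n, wfactor t beta n = C n * D n) /\
     alternatingly_hyperexpansive t C /\
     alternatingly_hyperexpansive (t + 1) D).
Proof.
  assert (hb : (0 < beta)%nat) by lia.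
  split; [|split; now apply wfactor_hyperexpansive_factorization].
  split; [apply hT|]. split; [now apply orthonormal_basis_e|]. split.
  - apply weight_sequence_mult; now apply weight_sequence_wfactor.
  - intros n. now apply toeplitz_e.
Qed.
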